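(* Let $S$ be a countable, discrete, bicancellative, and left amenable semigroup. Let $S\curvearrowright X$ and $S\curvearrowright Y$ be actions by proper maps on separable locally compact metric spaces, and let $\pi\colon X\to Y$ be a proper factor map. If $S\curvearrowright X$ is pointwise uniquely ergodic, then $S\curvearrowright Y$ is pointwise uniquely ergodic. Moreover, their pointwise ergodic maps satisfy $$\Phi_Y\circ\pi=\pi_*\circ\Phi_X.$$ If, in addition, $S\curvearrowright X$ is continuously pointwise ergodic, then $S\curvearrowright Y$ is continuously pointwise ergodic. If $S\curvearrowright X$ also vanishes at infinity, then so does $S\curvearrowright Y$. In consequence, if $S\curvearrowright X$ is uniform, then $S\curvearrowright Y$ is uniform.
   Context: For a separable locally compact metric space $X$: $C_0(X)$ is the Banach space (sup norm) of continuous $f\colon X\to\mathbb R$ with $\{|f|\ge\epsilon\}$ compact for every $\epsilon>0$; $M(X)\cong C_0(X)^*$ is the space of finite signed regular Borel measures with weak* topology $\sigma(M(X),C_0(X))$; $M_1^+(X)$ and $M_{\le1}^+(X)$ are the probability and subprobability measures. An action by proper maps is a map $(s,x)\mapsto sx$ with $(st)x=s(tx)$ and each $x\mapsto sx$ continuous and proper (preimages of compact sets are compact). A factor map $\pi\colon X\to Y$ is a continuous surjection with $\pi(sx)=s\pi(x)$ for all $s\in S,x\in X$; it is a proper factor map if moreover $\pi$ is proper. $\pi_*\nu(B)=\nu(\pi^{-1}(B))$ and $s_*\nu(A)=\nu(s^{-1}A)$; $\nu$ is $S$-invariant if $s_*\nu=\nu$ for all $s$. $M_1^+(\cdot,S)$,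 $M_{\le1}^+(\cdot,S)$ denote the $S$-invariant members (those on a closed invariant set are viewed as measures on the ambient space supported there). A point $x$ escapes to infinity if $\operatorname{cl}_X(Sx)$ is not compact, where $Sx=\{sx:s\in S\}$. The action is pointwise uniquely ergodic if $M_1^+(\operatorname{cl}_X(Sx),S)$ is empty for every $x$ escaping to infinity and a singleton $\{\mu_x\}$ for every other $x$; its pointwise ergodic map $\Phi_X\colon X\to M_{\le1}^+(X,S)$ is $\Phi_X(x)=0$ if $x$ escapes to infinity and $\Phi_X(x)=\mu_x$ otherwise (similarly $\Phi_Y$). It is continuously pointwise ergodic if it is pointwise uniquely ergodic and $\Phi_X$ is weak* continuous; such an action vanishes at infinity if $x\mapsto\int f\,d\Phi_X(x)$ belongs to $C_0(X)$ for every $f\in C_0(X)$. $S$ is bicancellative if $t_1s=t_2s$ or $st_1=st_2$ implies $t_1=t_2$. A sequence $(F_n)_n$ of non-empty finite subsets of $S$ is left F{\o}lner if $\lim_n|sF_n\Delta F_n|/|F_n|=0$ for every $s\in S$; $S$ is left amenable if one exists. The action is uniform if for every left F{\o}lner sequence $(F_n)_n$ and every $f\in C_0(X)$, the averages $\left(A_{F_n}f\right)(x)=\frac1{|F_n|}\sum_{t\in F_n}f(tx)$ converge in the uniform norm. *)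

(* Defs.v *)
From HB Require Import structures.
From mathcomp Require Import all_boot all_order all_algebra finmap.
From mathcomp Require Import all_classical all_reals all_analysis. 
From mathcomp Require Import giry.

Set Implicit Arguments.
Unset Strict Implicit.
Unset Printing Implicit Defensive.

Import Order.TTheory GRing.Theory Num.Theory.
Import numFieldNormedType.Exports.

Local Open Scope classical_set_scope.
Local Open Scope ring_scope.

(* The library's measurable types are pointed, hence so are the metric spaces
   carrying Borel measures here. *)
#[short(type="pmetricType")]
HB.structure Definition PointedMetric (K : numDomainType) :=
  {M of Metric K M & Pointed M}.

Section Semigroups.
Variable S : semigroupType.

Definition bicancellative :=
  (forall s t1 t2 : S, (t1 * s = t2 * s)%g -> t1 = t2) /\
  (forall s t1 t2 : S, (s * t1 = s * t2)%g -> t1 = t2).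

Definition ltranslate (s : S) (F : {fset S}) : {fset S} :=
  [fset (s * t)%g | t in F]%fset.

Definition fsymdiff (A B : {fset S}) : {fset S} :=
  ((A `\` B) `|` (B `\` A))%fset.

Definition left_folner (R : realType) (F : nat -> {fset S}) :=
  (forall n, F n != fset0) /\
  (forall s, (#|` fsymdiff (ltranslate s (F n)) (F n)|%:R / #|` F n|%:R : R)
               @[n --> \oo] --> (0 : R)).

Definition left_amenable (R : realType) := exists F, left_folner R F.

End Semigroups.

Definition separable (X : topologicalType) :=
  exists2 D : set X, countable D & dense D.

Definition proper_map (X Y : topologicalType) (f : X -> Y) :=
  continuous f /\ (forall K, compact K -> compact (f @^-1` K)).

Definition C0 (R : realType) (X : topologicalType) (f : X -> R) :=
  continuous f /\ (forall e, 0 < e -> compact [set x | e <= `|f x|]).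

Definition borel (R : realType) (X : pmetricType R) :=
  g_sigma_algebraType (@open X).

Section Measures.
Variables (R : realType) (X : pmetricType R).

(* Measures of the library are functions on all sets whose values are
   constrained on measurable sets only, so regularity, invariance and equality
   of measures are expressed on Borel sets. *)
Definition regular_measure (mu : {measure set (borel X) -> \bar R}) :=
  forall A : set (borel X), measurable A ->
    mu A = ereal_inf [set mu U | U in [set U : set X | open U /\ A `<=` U]] /\
    mu A = ereal_sup [set mu K | K in [set K : set X | compact K /\ K `<=` A]].

(* The topology induced by sigma(M(X), C_0(X)) on the subprobabilities: the
   initial topology for the evaluation into R^(C_0(X)), the latter being
   endowed with the product topology. *)
Definition C0_eval (mu : giry (borel X) R) :
    {ptws set_type (@C0 R X) -> R} :=
  fun f => \int[mu]_x (set_val f x).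

Definition weak_star : Type := giry (borel X) R.
HB.instance Definition _ :=
  Topological.copy weak_star (initial_topology C0_eval).

End Measures.

Definition proper_action (S : semigroupType) (X : topologicalType)
    (act : S -> X -> X) :=
  (forall s t x, act (s * t)%g x = act s (act t x)) /\
  (forall s, proper_map (act s)).

Definition factor_map (S : semigroupType) (X Y : topologicalType)
    (actX : S -> X -> X) (actY : S -> Y -> Y) (p : X -> Y) :=
  [/\ continuous p, set_surj setT setT p &
      forall s x, p (actX s x) = actY s (p x)].

Definition proper_factor_map (S : semigroupType) (X Y : topologicalType)
    (actX : S -> X -> X) (actY : S -> Y -> Y) (p : X -> Y) :=
  factor_map actX actY p /\ proper_map p.

Section Actions.
Variables (R : realType) (S : semigroupType) (X : pmetricType R).
Variable act : S -> X -> X.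

Definition orbit_closure (x : X) : set X := closure (range (act ^~ x)).

Definition escapes (x : X) := ~ compact (orbit_closure x).

Definition invariant_measure (mu : {measure set (borel X) -> \bar R}) :=
  forall (s : S) (A : set (borel X)), measurable A ->
    pushforward mu (act s : borel X -> borel X) A = mu A.

(* M_1^+(A, S), as a set of measures on X *)
Definition invariant_probs (A : set X) : set (probability (borel X) R) :=
  [set mu | [/\ regular_measure mu, mu (~` A) = 0%E & invariant_measure mu]].

Definition pointwise_uniquely_ergodic := forall x,
  (escapes x -> invariant_probs (orbit_closure x) = set0) /\
  (~ escapes x -> exists2 mu, invariant_probs (orbit_closure x) mu &
     forall nu, invariant_probs (orbit_closure x) nu -> measure_eq nu mu).

(* Phi_X. Outside of the pointwise uniquely ergodic case, get may return a
   junk value or an arbitrary choice. *)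
Definition ergodic_map (x : X) : weak_star X :=
  if pselect (escapes x) then (mzero : subprobability (borel X) R)
  else (get (invariant_probs (orbit_closure x)) : probability (borel X) R).

Definition continuously_pointwise_ergodic :=
  pointwise_uniquely_ergodic /\ continuous ergodic_map.

Definition vanishes_at_infinity := forall f : X -> R, C0 f ->
  C0 (fun x => \int[(ergodic_map x : giry (borel X) R)]_y f y : R).

Definition average (F : {fset S}) (f : X -> R) (x : X) : R :=
  (#|` F|%:R)^-1 * \sum_(t <- F) f (act t x).

(* Convergence takes place in the Banach space C_0(X). *)
Definition uniform_action := forall F : nat -> {fset S}, left_folner R F ->
  forall f : X -> R, C0 f ->
  exists2 g : X -> R, C0 g & {uniform, average (F n) f @[n --> \oo] --> g}.

End Actions.

(* Main.v *)
Require Import Defs.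
From HB Require Import structures.
From mathcomp Require Import all_boot all_order all_algebra finmap.
From mathcomp Require Import all_classical all_reals all_analysis. 
From mathcomp Require Import giry.
From mathcomp Require Import measurable_realfun ring lra.

(** Write [L] for the closure of the orbit of [x] and [p @` L] for that of
    [p x].  The whole statement rests on one fact, [lift_invariant_prob]: every
    invariant probability [nu] on [p @` L] is the image of an invariant
    probability on [L].  Images of invariant probabilities are invariant, and
    [x] escapes to infinity exactly when [p x] does because [p] is proper, so
    existence, uniqueness and the formula for the ergodic maps all descend from
    [X] to [Y].

    The lift is first built as a finitely additive probability on all subsets
    of [X], where every limit and every selection is harmless.
    - [fa_extension]: [nu] extends to all subsets of [Y], as an ultrafilter
      limit of finite combinations of point masses.
    - Pulling back along an arbitrary section of [p] that takes its values in
      [L] whenever it can gives a finitely additive probability that lives on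
      [L] and lies over [nu].
    - [fa_average]: an ultrafilter limit of Folner averages makes it invariant,
      by the usual estimate [mean_translate]; averaging does not move the image
      in [Y], since [nu] is already invariant.

    Countable additivity is recovered by regularization.  A finitely additive
    [m] defines [inner_mass m U], the supremum of [m] over the compact subsets of
    an open [U], and this extends to a regular Borel measure by Caratheodory's
    theorem, as in the construction of the measure in the Riesz
    representation theorem.  Proper maps exchange compact subsets of [U] with
    compact subsets of its preimage, so [inner_mass] commutes with them
    ([inner_mass_preimage]).  This single remark gives the invariance of the
    regularized measure, the fact that it lies over [nu], and, with [U] the
    whole space, that no mass is lost at infinity.

    The remaining claims are topological.  A proper map into a locally compact
    Hausdorff space is closed, so a function [g] on [Y] is continuous as soon as
    [g \o p] is, and likewise for membership in [C_0] ([continuous_descend],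
    [C0_descend]).  The integral of [g] against the ergodic map of [Y], composed
    with [p], is the integral of [g \o p] against the ergodic map of [X]; and
    averages satisfy the same relation.  Hence weak* continuity, vanishing at
    infinity and uniform convergence pass to [Y]. *)

Import Order.TTheory GRing.Theory Num.Theory.
Import numFieldNormedType.Exports.

Local Open Scope classical_set_scope.
Local Open Scope ring_scope.

Set Implicit Arguments.
Unset Strict Implicit.
Unset Printing Implicit Defensive.

(** * Finitely additive probabilities and their limits *)

Lemma ultra_cvg_compact (I : Type) (T : topologicalType) (G : set_system I)
    (K : set T) (u : I -> T) :
  UltraFilter G -> compact K -> (\forall i \near G, K (u i)) ->
  exists l : T, u i @[i --> G] --> l.
Proof.
move=> UG cK GK; have [l [_ lu]] := cK (u i @[i --> G]) _ GK.
exists l => A lA; have [//|GnA] := in_ultra_setVsetC (u @^-1` A) UG.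
by have [t [nAt At]] := lu (~` A) A GnA lA.
Qed.

Section FiniteAdditivity.
Variables (R : realType) (T : Type).
Implicit Types (m : set T -> R) (A B : set T).

Definition fa_prob m :=
  [/\ forall A, 0 <= m A, m setT = 1 &
      forall A B, A `&` B = set0 -> m (A `|` B) = m A + m B].

Lemma fa_prob0 m : fa_prob m -> m set0 = 0.
Proof.
case=> _ _ mD; have := mD set0 set0 (setI0 _).
by rewrite setU0 => /eqP; rewrite -subr_eq0 opprD addNKr oppr_eq0 => /eqP.
Qed.

Lemma le_fa_prob m A B : fa_prob m -> A `<=` B -> m A <= m B.
Proof.
case=> m0 _ mD AB.
by rewrite -(setDUK AB) mD ?setDIK// lerDl.
Qed.

Lemma fa_prob_le1 m A : fa_prob m -> m A <= 1.
Proof. by move=> fm; have [_ <- _] := fm; apply: le_fa_prob. Qed.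

Lemma fa_probU m A B : fa_prob m -> m (A `|` B) <= m A + m B.
Proof.
move=> fm; have [_ _ mD] := fm.
have -> : A `|` B = A `|` (B `\` A) by rewrite setUDr setDv setD0.
by rewrite mD ?setDIK// lerD2l; apply: le_fa_prob => //; exact: subDsetl.
Qed.

(** Refining the filter to an ultrafilter makes all the bounded functions
    [fun i => m_ i A] converge at once.  Keeping the refinement [G] in the
    conclusion lets a user transfer to the limit any relation that holds along
    [F], such as an asymptotic invariance. *)
Lemma fa_limit (I : Type) (F : set_system I) (m_ : I -> set T -> R) :
  ProperFilter F -> (\forall i \near F, fa_prob (m_ i)) ->
  exists (G : set_system I) (m : set T -> R),
    [/\ ProperFilter G, F `<=` G, fa_prob m &
        forall A, m_ i A @[i --> G] --> m A].
Proof.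
move=> PF Fm; have [G [UG FG]] := ultraFilterLemma PF.
have Gm := FG _ Fm.
have cvgm A : exists l : R, m_ i A @[i --> G] --> l.
  apply: (ultra_cvg_compact UG (@segment_compact R 0 1)).
  near=> i; have fmi : fa_prob (m_ i) by near: i.
  by rewrite /= in_itv/= fa_prob_le1// andbT; case: fmi.
pose m A := sval (cid (cvgm A)).
have mE A : m_ i A @[i --> G] --> m A by exact: svalP (cid (cvgm A)).
exists G, m; split; [exact: ultra_proper|by []| |by []]; split=> [A||A B AB].
- apply: (cvgr_to_ge (mE A)); near=> i.
  by have [] : fa_prob (m_ i) by near: i.
- apply: (cvg_unique _ (mE setT)) => //; apply: cvg_near_cst.
  by near=> i; have [] : fa_prob (m_ i) by near: i.
- apply: (cvg_unique _ (mE (A `|` B))) => //.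
  apply: cvg_trans (cvgD (mE A) (mE B)); apply: near_eq_cvg.
  by near=> i; have [_ _ ->] : fa_prob (m_ i) by near: i.
Unshelve. all: by end_near. Qed.

End FiniteAdditivity.

(** * Extending a probability to all subsets *)

Section Extension.
Context {d} {T : measurableType d} {R : realType} (P : probability T R).
Implicit Types (s : seq (set T)) (A B C : set T).

Let rep C : T := xget point C.

(** The value at [A] of the combination of point masses that puts the mass of
    each cell of the partition of [C] generated by [s] at a representative of
    that cell.  Splitting by one member of [s] at a time spares any indexing of
    the cells. *)
Fixpoint cell_mass s C A : R :=
  if s is B :: s' then cell_mass s' (C `&` B) A + cell_mass s' (C `\` B) A
  else fine (P C) * \1_A (rep C).

Let measurable_seq s := forall B, B \in s -> measurable B.

Let measurable_seq_cons B s :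
  measurable_seq (B :: s) -> measurable B /\ measurable_seq s.
Proof.
move=> ms; split; first by apply: ms; rewrite mem_head.
by move=> C Cs; apply: ms; rewrite in_cons Cs orbT.
Qed.

Let fine_measureDI C B : measurable C -> measurable B ->
  fine (P (C `&` B)) + fine (P (C `\` B)) = fine (P C).
Proof.
move=> mC mB; rewrite [in RHS](measureDI P mC mB) addrC fineD//.
- by apply: fin_num_measure; exact: measurableD.
- by apply: fin_num_measure; exact: measurableI.
Qed.

Lemma cell_mass_ge0 s C A : 0 <= cell_mass s C A.
Proof.
elim: s C => [|B s IH] C /=; last by rewrite addr_ge0.
by rewrite mulr_ge0// fine_ge0.
Qed.

Lemma cell_massD s C A B : A `&` B = set0 ->
  cell_mass s C (A `|` B) = cell_mass s C A + cell_mass s C B.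
Proof.
move=> AB0; elim: s C => [|D s IH] C /=; last by rewrite !IH addrACA.
have : (rep C \in A) && (rep C \in B) = false by rewrite -in_setI AB0 in_set0.
rewrite -mulrDr !indicE in_setU; case: (_ \in A); case: (_ \in B) => //= _;
  by rewrite ?addr0 ?add0r.
Qed.

Lemma cell_mass_sub s C A : measurable_seq s -> measurable C -> C `<=` A ->
  cell_mass s C A = fine (P C).
Proof.
elim: s C => [|B s IH] C ms mC CA /=.
  have [->|/set0P C0] := eqVneq C set0; first by rewrite measure0 mul0r.
  by rewrite indicE mem_set ?mulr1//; apply: CA; exact: xgetPex.
have [mB ms'] := measurable_seq_cons ms.
rewrite !IH ?fine_measureDI//; [exact: measurableD|by move=> x [/CA]|
  exact: measurableI|by move=> x [/CA]].
Qed.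

Lemma cell_mass_disj s C A : measurable_seq s -> measurable C ->
  C `&` A = set0 -> cell_mass s C A = 0.
Proof.
elim: s C => [|B s IH] C ms mC CA /=.
  have [->|/set0P C0] := eqVneq C set0; first by rewrite measure0 mul0r.
  rewrite indicE memNset ?mulr0// => Ar.
  suff : (C `&` A) (rep C) by rewrite CA.
  by split => //; exact: xgetPex.
have [mB ms'] := measurable_seq_cons ms.
rewrite !IH ?addr0//; [exact: measurableD|by rewrite setIDAC setIDA CA set0D|
  exact: measurableI|by rewrite setIAC CA set0I].
Qed.

(** The cells refine every member of [s], so the point masses see the members
    of [s] exactly as [P] does. *)
Lemma cell_mass_mem s C A : measurable_seq s -> measurable C -> A \in s ->
  cell_mass s C A = fine (P (C `&` A)).
Proof.
elim: s C => [//|B s IH] C ms mC; have [mB ms'] := measurable_seq_cons ms.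
rewrite in_cons => /orP[/eqP ->|As] /=.
  rewrite cell_mass_sub//; [|exact: measurableI].
  rewrite cell_mass_disj ?addr0//; first exact: measurableD.
  by rewrite setDE -setIA setICl setI0.
have mA := ms' _ As.
rewrite !IH//; [|exact: measurableD|exact: measurableI].
rewrite setIAC setIDAC setIDA; apply: fine_measureDI => //; exact: measurableI.
Qed.

(** Finite lists of measurable sets are directed by inclusion, and any given
    measurable set is eventually a member of the list, where [cell_mass] already
    agrees with [P]. *)
Lemma fa_extension : exists m : set T -> R,
  fa_prob m /\ forall B, measurable B -> m B = fine (P B).
Proof.
pose D s := [set t | measurable_seq t /\ {subset s <= t}].
have PF : ProperFilter (filter_from measurable_seq D).
  apply: filter_from_proper => [|s ms]; last by exists s; split.
  apply: filter_from_filter => [|s t ms mt]; first by exists [::].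
  exists (s ++ t).
    by move=> B; rewrite mem_cat => /orP[/ms|/mt].
  move=> u [mu stu]; split; split => // B Bst; apply: stu;
    by rewrite mem_cat Bst// orbT.
have [|G [m [PG FG fm mE]]] := @fa_limit R T _ _ (fun s => cell_mass s setT) PF.
  exists [::] => // s [ms _]; split=> [A||A B].
  - exact: cell_mass_ge0.
  - by rewrite cell_mass_sub// probability_setT.
  - exact: cell_massD.
exists m; split => // B mB; apply: (cvg_unique _ (mE B)) => //.
apply: cvg_near_cst; apply: FG; exists [:: B].
  by move=> C; rewrite inE => /eqP ->.
move=> s [ms Bs]; rewrite cell_mass_mem ?setTI//.
by apply: Bs; rewrite mem_head.
Qed.

End Extension.

(** * Averaging along a Folner sequence *)

Section Averages.
Variables (R : realType) (S : semigroupType).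
Implicit Types (F : {fset S}) (g : S -> R).

Definition mean F g : R := (#|` F|%:R)^-1 * \sum_(t <- F) g t.

Lemma mean_cst F (c : R) : F != fset0 -> mean F (fun=> c) = c.
Proof.
move=> F0; rewrite /mean big_const_seq count_predT iter_addr_0 -(mulr_natl c).
by rewrite mulrA mulVf ?mul1r// pnatr_eq0 cardfs_eq0.
Qed.

(** Left cancellation turns the translated sum into the sum over the translate
    [s F]; the common part of [s F] and [F] cancels and each remaining term
    contributes at most 1. *)
Lemma mean_translate F g s :
  (forall t1 t2, (s * t1 = s * t2)%g -> t1 = t2) ->
  (forall t, 0 <= g t <= 1) ->
  `|mean F (fun t => g (s * t)%g) - mean F g| <=
  #|` fsymdiff (ltranslate s F) F|%:R / #|` F|%:R.
Proof.
move=> sI g01; rewrite /mean -mulrBr normrM normfV normr_nat mulrC.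
rewrite ler_wpM2r ?invr_ge0//.
have -> : \sum_(t <- F) g (s * t)%g = \sum_(t <- ltranslate s F) g t.
  by rewrite /ltranslate big_imfset//= => t1 t2 _ _; exact: sI.
have sumI (A B : {fset S}) : \sum_(t <- A) g t =
    \sum_(t <- (A `&` B)%fset) g t + \sum_(t <- (A `\` B)%fset) g t.
  rewrite [LHS](big_fsetID _ [in B])/=.
  by congr (\sum_(t <- enum_fset _) g t + \sum_(t <- enum_fset _) g t);
    apply/fsetP => t; rewrite !inE/= 1?andbC.
rewrite (sumI (ltranslate s F) F) (sumI F (ltranslate s F)) fsetIC.
rewrite opprD addrACA subrr add0r.
have sum_card (A : {fset S}) : 0 <= \sum_(t <- A) g t <= #|` A|%:R.
  rewrite sumr_ge0 => [|t _]; last by case/andP: (g01 t).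
  rewrite (@le_trans _ _ (\sum_(t <- A) 1))//.
    by apply: ler_sum => t _; case/andP: (g01 t).
  by rewrite big_const_seq count_predT iter_addr_0.
rewrite /fsymdiff cardfsU (_ : (_ `&` _)%fset = fset0); last first.
  by apply/fsetP => t; rewrite !inE; case: (t \in F); rewrite ?andbF.
rewrite cardfs0 subn0 natrD.
have /andP[a0 a1] := sum_card (ltranslate s F `\` F)%fset.
have /andP[b0 b1] := sum_card (F `\` ltranslate s F)%fset.
by rewrite ler_norml; apply/andP; split; lra.
Qed.

End Averages.

Section InvariantMean.
Variables (R : realType) (S : semigroupType) (X : Type) (act : S -> X -> X).
Hypothesis actM : forall s t x, act (s * t)%g x = act s (act t x).
Hypothesis lcancel : forall s t1 t2 : S, (s * t1 = s * t2)%g -> t1 = t2.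

Lemma fa_mean (F : {fset S}) (m : set X -> R) : F != fset0 -> fa_prob m ->
  fa_prob (fun A => mean F (fun t => m (act t @^-1` A))).
Proof.
move=> F0 [m0 m1 mD]; split=> [A||A B AB].
- by rewrite mulr_ge0 ?invr_ge0// sumr_ge0.
- by rewrite -[RHS](@mean_cst R S F)//; congr mean; apply/funext => t; exact: m1.
- rewrite -mulrDr -big_split/=; congr (_ * _); apply: eq_bigr => t _.
  by rewrite preimage_setU mD// -preimage_setI AB preimage_set0.
Qed.

(** The last clause keeps any value shared by all the translates of a set; it
    carries both the support and the image of [m0] over to [m]. *)
Lemma fa_average (F : nat -> {fset S}) (m0 : set X -> R) :
  left_folner R F -> fa_prob m0 ->
  exists m : set X -> R, [/\ fa_prob m,
    forall s A, m (act s @^-1` A) = m A &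
    forall A c, (forall t, m0 (act t @^-1` A) = c) -> m A = c].
Proof.
move=> [F0 Fs] fm0.
have [|G [m [PG FG fm mE]]] := @fa_limit R X _ \oo
    (fun n A => mean (F n) (fun t => m0 (act t @^-1` A))) _.
  by apply: nearW => n; exact: fa_mean.
exists m; split => // [s A|A c Ac]; last first.
  apply: (cvg_unique _ (mE A)) => //; apply: cvg_near_cst.
  apply: nearW => n; rewrite -[RHS](@mean_cst R S (F n))//.
  by congr mean; apply/funext => t.
apply/eqP; rewrite -subr_eq0; apply/eqP.
apply: (cvg_unique _ (cvgB (mE (act s @^-1` A)) (mE A))) => //.
apply: norm_cvg0; apply: (@squeeze_cvgr _ _ _ _ (cst 0)
  (fun n => #|` fsymdiff (ltranslate s (F n)) (F n)|%:R / #|` F n|%:R)).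
- apply: nearW => n; rewrite normr_ge0/=.
  have actE t : act t @^-1` (act s @^-1` A) = act (s * t)%g @^-1` A.
    by apply/seteqP; split=> x /=; rewrite actM.
  rewrite [X in `|X|](_ : _ = mean (F n) (fun t => m0 (act (s * t)%g @^-1` A)) -
      mean (F n) (fun t => m0 (act t @^-1` A))); last first.
    by congr (mean _ _ - _); apply/funext => t; rewrite actE.
  apply: (mean_translate (F n) (g := fun t => m0 (act t @^-1` A))).
    exact: lcancel.
  by move=> t; rewrite fa_prob_le1// andbT; case: fm0.
- exact: cvg_cst.
- exact: cvg_trans (cvg_app _ FG) (Fs s).
Qed.

End InvariantMean.

(** * Regularizing a finitely additive probability *)

Section Regularization.
Variables (R : realType) (X : pmetricType R).
Implicit Types (m : set X -> R) (A K U V : set X).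
Local Open Scope ereal_scope.

Definition inner_mass m U : \bar R :=
  ereal_sup [set (m K)%:E | K in [set K | compact K /\ K `<=` U]].

Definition outer_mass m A : \bar R :=
  ereal_inf [set inner_mass m U | U in [set U | open U /\ A `<=` U]].

Lemma le_inner_mass_compact m K U :
  compact K -> K `<=` U -> (m K)%:E <= inner_mass m U.
Proof. by move=> cK KU; apply: ereal_sup_ubound; exists K. Qed.

Lemma inner_mass_le m U x :
  (forall K, compact K -> K `<=` U -> (m K)%:E <= x) -> inner_mass m U <= x.
Proof. by move=> Kx; apply: ge_ereal_sup => _ [K [cK KU] <-]; exact: Kx. Qed.

Lemma compactD_open K U : compact K -> open U -> compact (K `\` U).
Proof.
by move=> cK oU; rewrite setDE; apply: compact_closedI => //; exact: open_closedC.
Qed.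

(** The disjoint closed sets [K `\` V] and [K `\` U] have disjoint open
    neighbourhoods; remove from [K] either of the two. *)
Lemma compact_split K U V : compact K -> open U -> open V -> K `<=` U `|` V ->
  exists K1 K2, [/\ compact K1, compact K2, K1 `<=` U, K2 `<=` V &
    K = K1 `|` K2].
Proof.
move=> cK oU oV KUV.
have hX : hausdorff_space X := @metric_hausdorff R X.
have clD W : open W -> closed (K `\` W).
  by move=> oW; apply: compact_closed => //; exact: compactD_open.
have [|U' [V' [oU' oV' KVU' KUV' UV0]]] :=
    (@normal_openP R X).1 pseudometric_normal (K `\` V) (K `\` U) (clD _ oV) (clD _ oU).
  apply/seteqP; split=> // x [[Kx nVx] [_ nUx]].
  by have [] := KUV x Kx.
exists (K `\` V'), (K `\` U'); split; [exact: compactD_open|exact: compactD_open| | |].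
- by move=> x [Kx nVx]; apply: contrapT => nUx; apply: nVx; apply: KUV'.
- by move=> x [Kx nUx]; apply: contrapT => nVx; apply: nUx; apply: KVU'.
- apply/seteqP; split=> [x Kx|x [[]|[]]//].
  have [Vx|nVx] := pselect (V' x); last by left.
  right; split => // Ux; suff : (U' `&` V') x by rewrite UV0.
  by split.
Qed.

Section FixedMass.
Variable m : set X -> R.
Hypothesis fm : fa_prob m.

Lemma inner_mass_ge0 U : 0 <= inner_mass m U.
Proof.
rewrite -(_ : (m set0)%:E = 0); last by rewrite fa_prob0.
by apply: le_inner_mass_compact => //; exact: compact0.
Qed.

Lemma le_inner_mass U V : U `<=` V -> inner_mass m U <= inner_mass m V.
Proof.
move=> UV; apply: inner_mass_le => K cK KU; apply: le_inner_mass_compact => //.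
exact: subset_trans KU UV.
Qed.

Lemma inner_mass_le1 U : inner_mass m U <= 1.
Proof. by apply: inner_mass_le => K _ _; rewrite lee_fin fa_prob_le1. Qed.

Lemma inner_mass_fin_num U : inner_mass m U \is a fin_num.
Proof.
rewrite ge0_fin_numE ?inner_mass_ge0//.
by rewrite (le_lt_trans (inner_mass_le1 _))// ltry.
Qed.

Lemma inner_mass0 : inner_mass m set0 = 0.
Proof.
apply/eqP; rewrite eq_le inner_mass_ge0 andbT; apply: inner_mass_le => K _.
by rewrite subset0 => ->; rewrite fa_prob0.
Qed.

Lemma inner_massU U V : open U -> open V ->
  inner_mass m (U `|` V) <= inner_mass m U + inner_mass m V.
Proof.
move=> oU oV; apply: inner_mass_le => K cK KUV.
have [K1 [K2 [cK1 cK2 K1U K2V ->]]] := compact_split cK oU oV KUV.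
rewrite (@le_trans _ _ ((m K1)%:E + (m K2)%:E))//.
  by rewrite -EFinD lee_fin fa_probU.
by apply: leeD; exact: le_inner_mass_compact.
Qed.

(** This is where finite additivity becomes countable: a compact subset of the
    union is covered by finitely many of the open sets. *)
Lemma inner_mass_bigcup (U : (set X)^nat) : (forall n, open (U n)) ->
  inner_mass m (\bigcup_n U n) <= \sum_(n <oo) inner_mass m (U n).
Proof.
move=> oU; apply: inner_mass_le => K; rewrite compact_cover => cK KU.
have [|D _ KD] := cK nat setT U _ KU; first by move=> n _; exact: oU.
pose N := (\max_(i <- D) i).+1.
have KN : K `<=` \big[setU/set0]_(i < N) U i.
  move=> x /KD[i /= Di Uix]; rewrite -bigcup_mkord; exists i => //=.
  by rewrite ltnS; apply: leq_bigmax_seq.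
have UN : inner_mass m (\big[setU/set0]_(i < N) U i) <=
    \sum_(i < N) inner_mass m (U i).
  elim: N {KN} => [|n IH]; first by rewrite !big_ord0 inner_mass0.
  rewrite !big_ord_recr/= (le_trans (inner_massU _ _))// ?leeD2r//.
  by rewrite -bigcup_mkord; apply: bigcup_open => i _; exact: oU.
rewrite (@le_trans _ _ (inner_mass m (\big[setU/set0]_(i < N) U i)))//.
  by apply: le_inner_mass_compact => //; rewrite compact_cover.
rewrite (le_trans UN)// -(big_mkord xpredT (fun i => inner_mass m (U i))).
by apply: nneseries_lim_ge => n _ _; exact: inner_mass_ge0.
Qed.

Lemma outer_mass_open U : open U -> outer_mass m U = inner_mass m U.
Proof.
move=> oU; apply/eqP; rewrite eq_le; apply/andP; split.
  by apply: ereal_inf_lbound; exists U => //; split.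
by apply: le_ereal_inf_tmp => _ [V [oV UV] <-]; exact: le_inner_mass.
Qed.

Lemma outer_mass_ge0 A : 0 <= outer_mass m A.
Proof. by apply: le_ereal_inf_tmp => _ [V _ <-]; exact: inner_mass_ge0. Qed.

Lemma le_outer_mass A B : A `<=` B -> outer_mass m A <= outer_mass m B.
Proof.
move=> AB; apply: le_ereal_inf_tmp => _ [V [oV BV] <-]; apply: ereal_inf_lbound.
by exists V => //; split => //; exact: subset_trans AB BV.
Qed.

Lemma outer_mass_le1 A : outer_mass m A <= 1.
Proof.
rewrite (le_trans (le_outer_mass (@subsetT _ A)))// outer_mass_open.
  exact: inner_mass_le1.
exact: openT.
Qed.

Lemma outer_mass_fin_num A : outer_mass m A \is a fin_num.
Proof.
rewrite ge0_fin_numE ?outer_mass_ge0//.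
by rewrite (le_lt_trans (outer_mass_le1 _))// ltry.
Qed.

Lemma outer_mass_approx A (e : R) : (0 < e)%R ->
  exists U, [/\ open U, A `<=` U & inner_mass m U <= outer_mass m A + e%:E].
Proof.
move=> e0; have [_ [U [oU AU] <-] Ue] := lb_ereal_inf_adherent e0 (outer_mass_fin_num A).
by exists U; split => //; exact: ltW.
Qed.

Lemma outer_mass_sigma_subadditive : sigma_subadditive (outer_mass m).
Proof.
move=> A; apply/lee_addgt0Pr => e e0.
have /choice[U AU] n : exists U, [/\ open U, A n `<=` U &
    inner_mass m U <= outer_mass m (A n) + (e / (2 ^ n.+1)%:R)%:E].
  by apply: outer_mass_approx; rewrite divr_gt0// ltr0n expn_gt0.
apply: le_trans (epsilon_trick _ _ (ltW e0)) => [|n]; last exact: outer_mass_ge0.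
rewrite (@le_trans _ _ (inner_mass m (\bigcup_n U n)))//.
  apply: ereal_inf_lbound; exists (\bigcup_n U n) => //; split.
    by apply: bigcup_open => n _; have [] := AU n.
  by apply: subset_bigcup => n _; have [] := AU n.
rewrite (le_trans (inner_mass_bigcup _))// => [n|]; first by have [] := AU n.
by apply: lee_nneseries => n _ => [_|]; [exact: inner_mass_ge0|have [] := AU n].
Qed.

Lemma outer_mass0 : outer_mass m set0 = 0.
Proof. by rewrite outer_mass_open ?inner_mass0//; exact: open0. Qed.

Let mass_outer_mixin := isOuterMeasure.Build R X (outer_mass m)
  outer_mass0 outer_mass_ge0 le_outer_mass outer_mass_sigma_subadditive.
Let mass_outer : {outer_measure set X -> \bar R} :=
  HB.pack (outer_mass m) mass_outer_mixin.

(** Choose [V] around [A] almost optimally, then a compact [K] that almost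
    exhausts [V `&` U], and finally compact subsets [K'] of the open set
    [V `\` K], which contains [A `\` U].  As [K] and [K'] are disjoint compact
    subsets of [V], their masses add up to at most that of [V]. *)
Lemma open_caratheodory U : open U -> caratheodory_measurable (outer_mass m) U.
Proof.
move=> oU; apply: (@le_caratheodory_measurable R X mass_outer) => A /=.
apply/lee_addgt0Pr => e e0; have e20 : (0 < e / 2)%R by rewrite divr_gt0.
have [V [oV AV Ve]] := outer_mass_approx A e20.
apply: (@le_trans _ _ (inner_mass m V + (e / 2)%:E)); last first.
  by rewrite [in leRHS](splitr e) EFinD addeA leeD2r.
have oVU : open (V `&` U) by exact: openI.
have [_ [K [cK KVU] <-] Ke] := ub_ereal_sup_adherent e20 (inner_mass_fin_num (V `&` U)).
have oVK : open (V `\` K).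
  rewrite setDE; apply: openI => //; apply: closed_openC.
  by apply: compact_closed => //; exact: metric_hausdorff.
rewrite (@le_trans _ _ (inner_mass m (V `&` U) + inner_mass m (V `\` K)))//.
  rewrite -!outer_mass_open//; apply: leeD; apply: le_outer_mass.
    exact: setSI.
  by move=> x [Ax nUx]; split; [exact: AV|move=> /KVU[]].
rewrite -leeBrDl ?inner_mass_fin_num//; apply: inner_mass_le => K' cK' K'V.
rewrite leeBrDl ?inner_mass_fin_num//.
move: Ke; rewrite lteBlDr// => /ltW Ke; rewrite (le_trans (leeD2r _ Ke))//.
rewrite addeAC leeD2r// -EFinD; have [_ _ <-] := fm; last first.
  by apply/seteqP; split=> // x [Kx /K'V[]].
apply: le_inner_mass_compact; first exact: compactU.
by move=> x [/KVU[]|/K'V[]].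
Qed.

Lemma borel_caratheodory (A : set (borel X)) :
  measurable A -> caratheodory_measurable (outer_mass m) A.
Proof.
apply: smallest_sub; last exact: open_caratheodory.
have := @sigma_algebra_measurable _ (caratheodory_type mass_outer).
exact.
Qed.

Lemma outer_mass_sigma_additive :
  semi_sigma_additive (outer_mass m : set (borel X) -> \bar R).
Proof.
move=> F mF tF mUF.
apply: (@caratheodory_measure_sigma_additive R X mass_outer) => //.
  by move=> n; exact: borel_caratheodory.
exact: borel_caratheodory.
Qed.

End FixedMass.

Section RegularMeasure.
Variable m : set X -> R.
Hypotheses (fm : fa_prob m) (tight : inner_mass m setT = 1).

(** The two proofs are arguments so that the probability structure attached to
    this function can be inferred from the term itself.  The hypothesis on
    [setT] is tightness: compact sets carry almost all the mass. *)
Definition regularization of fa_prob m & inner_mass m setT = 1 :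
  set (borel X) -> \bar R := outer_mass m.

Local Notation mu := (regularization fm tight).

Let mu0 : mu set0 = 0. Proof. exact: outer_mass0. Qed.

Let mu_ge0 A : 0 <= mu A. Proof. exact: outer_mass_ge0. Qed.

Let mu_sigma_additive : semi_sigma_additive mu.
Proof. exact: outer_mass_sigma_additive. Qed.

HB.instance Definition _ := isMeasure.Build _ _ _ mu
  mu0 mu_ge0 mu_sigma_additive.

Let mu_setT : mu setT = 1.
Proof. by rewrite /regularization outer_mass_open//; exact: openT. Qed.

HB.instance Definition _ := Measure_isProbability.Build _ _ _ mu mu_setT.

Lemma regularization_open U : open U -> mu U = inner_mass m U.
Proof. exact: outer_mass_open. Qed.

End RegularMeasure.

End Regularization.

(** * Regular Borel probabilities on a metric space *)

Section BorelMeasures.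
Variables (R : realType) (X : pmetricType R).
Implicit Types (P : probability (borel X) R) (A K U : set X).
Local Open Scope ereal_scope.

Lemma open_measurable_borel U : open U -> measurable (U : set (borel X)).
Proof. exact: sub_sigma_algebra. Qed.

Lemma closed_measurable_borel K : closed K -> measurable (K : set (borel X)).
Proof.
move=> cK; rewrite -(setCK K); apply: measurableC.
by apply: open_measurable_borel; exact: closed_openC.
Qed.

Lemma compact_measurable_borel K : compact K -> measurable (K : set (borel X)).
Proof.
move=> cK; apply: closed_measurable_borel.
by apply: compact_closed => //; exact: metric_hausdorff.
Qed.

Lemma eq_open_borel P1 P2 : (forall U, open U -> P1 U = P2 U) ->
  measure_eq P1 P2.
Proof.
move=> P12 A mA.
apply: (@measure_unique _ R (borel X) (@open X) (fun=> setT)) => //.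
- exact: openI.
- by move=> _; exact: openT.
- by rewrite bigcup_const.
- by move=> _; rewrite (le_lt_trans (probability_le1 P1 measurableT))// ltry.
Qed.

(** Outer approximation of [A] is inner approximation of its complement,
    compact sets being closed and the total mass finite. *)
Lemma regular_inner P :
  (forall (A : set (borel X)), measurable A -> forall e : R, (0 < e)%R ->
     exists K, [/\ compact K, K `<=` A & P A <= P K + e%:E]) ->
  regular_measure P.
Proof.
move=> inn A mA; split; apply/eqP; rewrite eq_le; apply/andP; split.
- apply: le_ereal_inf_tmp => _ [U [oU AU] <-]; apply: le_measure => //.
  + exact/mem_set.
  + by apply/mem_set; exact: open_measurable_borel.
- apply/lee_addgt0Pr => e e0.
  have mCA : measurable (~` A) by exact: measurableC.
  have [K [cK KA PK]] := inn _ mCA _ e0.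
  have mK := compact_measurable_borel cK.
  apply: (@le_trans _ _ (P (~` K))).
    apply: ereal_inf_lbound; exists (~` K) => //; split.
      by apply: closed_openC; apply: compact_closed => //; exact: metric_hausdorff.
    by move=> x Ax Kx; exact: KA Kx Ax.
  change (P (~` K) <= P A + e%:E).
  move: PK; rewrite [P (~` A)]probability_setC// [P (~` K)]probability_setC//.
  rewrite -(fineK (fin_num_measure P _ mA)) -(fineK (fin_num_measure P _ mK)).
  rewrite -!EFinB -!EFinD !lee_fin; lra.
- apply/lee_addgt0Pr => e e0; have [K [cK KA PK]] := inn A mA e e0.
  by rewrite (le_trans PK)// leeD2r//; apply: ereal_sup_ubound; exists K.
- apply: ge_ereal_sup => _ [K [cK KA] <-]; apply: le_measure => //.
  + by apply/mem_set; exact: compact_measurable_borel.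
  + exact/mem_set.
Qed.

Lemma inner_regular P (A : set (borel X)) (e : R) :
  regular_measure P -> measurable A -> (0 < e)%R ->
  exists K, [/\ compact K, K `<=` A & P A <= P K + e%:E].
Proof.
move=> rP mA e0; have [_ PA] := rP A mA.
have := fin_num_measure P _ mA; rewrite PA => /(ub_ereal_sup_adherent e0).
move=> [_ [K [cK KA] <-]]; rewrite -PA lteBlDr// => PK; exists K; split => //.
exact: ltW.
Qed.

(** An open set [U] slightly larger than [~` A] leaves a closed subset of [A];
    intersecting it with a compact set [K0] given by tightness makes it compact
    at the cost of another [e / 2]. *)
Lemma regularization_regular (m : set X -> R) (fm : fa_prob m)
    (tight : inner_mass m setT = 1) : regular_measure (regularization fm tight).
Proof.
pose mu : probability (borel X) R := regularization fm tight.
change (regular_measure mu).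
apply: regular_inner => A mA e e0; have e20 : (0 < e / 2)%R by rewrite divr_gt0.
have mCA : measurable (~` A) by exact: measurableC.
have [U [oU CAU Ue]] := outer_mass_approx fm (~` A) e20.
have mU := open_measurable_borel oU.
have [] := @ub_ereal_sup_adherent R _ _ e20 (inner_mass_fin_num fm setT).
move=> _ [K0 [cK0 _] <-]; rewrite -/(inner_mass m setT) tight => K0e.
have mK0 := compact_measurable_borel cK0.
have muK0 : (m K0)%:E <= mu K0.
  apply: le_ereal_inf_tmp => _ [V [oV KV] <-]; exact: le_inner_mass_compact.
exists (K0 `\` U); split.
- exact: compactD_open.
- by move=> x [_ nUx]; apply: contrapT => nAx; apply: nUx; exact: CAU.
have mD : measurable (K0 `\` U : set (borel X)) by exact: measurableD.
have le1 : mu K0 <= mu (K0 `\` U) + mu U.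
  apply: (le_trans _ (measureU2 _ _ _)) => //; apply: le_measure.
  - exact/mem_set.
  - by apply/mem_set; exact: measurableU.
  - by move=> x Kx; have [Ux|nUx] := pselect (U x); [right|left].
have UE : mu U <= mu (~` A) + (e / 2)%:E.
  have -> : mu U = inner_mass m U by exact: regularization_open.
  exact: Ue.
move: UE le1 muK0 K0e; rewrite [mu (~` A)]probability_setC//.
rewrite -(fineK (fin_num_measure mu _ mA)) -(fineK (fin_num_measure mu _ mK0)).
rewrite -(fineK (fin_num_measure mu _ mU)) -(fineK (fin_num_measure mu _ mD)).
rewrite -!EFinB -!EFinD !lee_fin lte_fin; lra.
Qed.

End BorelMeasures.

(** * Continuous and proper maps *)

Section TopologicalMaps.
Variables (X Y : topologicalType) (f : X -> Y).

Lemma compact_image (K : set X) :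
  continuous f -> compact K -> compact (f @` K).
Proof. by move=> cf; apply: continuous_compact; exact: continuous_subspaceT. Qed.

Lemma image_closure (A : set X) :
  continuous f -> f @` closure A `<=` closure (f @` A).
Proof.
move=> cf _ [x clx <-].
have clf : closed (f @^-1` closure (f @` A)).
  by apply: preimage_closed => [? _|]; [exact: cf|exact: closed_closure].
have : closure A `<=` f @^-1` closure (f @` A).
  rewrite [X in _ `<=` X]((closure_id _).1 clf); apply: closureS => a Aa.
  by apply: subset_closure; exists a.
exact.
Qed.

(** Near a point [y] with compact neighbourhood [V], the image of [C] is the
    image of the compact set [C `&` f @^-1` V]. *)
Lemma proper_closed (C : set X) :
  hausdorff_space Y -> locally_compact [set: Y] -> proper_map f ->
  closed C -> closed (f @` C).
Proof.
move=> hY lcY [cf kf] clC y clfy.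
have [V Vy [cV clV]] := lcY y I; rewrite withinET in Vy.
have /(compact_closed hY) clW : compact (f @` (C `&` f @^-1` V)).
  apply: compact_image => //; rewrite setIC; apply: compact_closedI => //.
  exact: kf.
have : (f @` (C `&` f @^-1` V)) y.
  apply: clW => U Uy.
  have [_ [[x Cx <-] [Ufx Vfx]]] := clfy (U `&` V) (filterI Uy Vy).
  by exists (f x); split => //; exists x.
by move=> [x [Cx _] <-]; exists x.
Qed.

End TopologicalMaps.

Section QuotientFunctions.
Variables (R : realType) (X Y : topologicalType) (p : X -> Y).
Hypothesis pp : proper_map p.

Lemma C0_comp (g : Y -> R) : C0 g -> C0 (g \o p).
Proof.
move=> [cg kg]; split=> [x|e e0]; last exact: (pp.2 _ (kg e e0)).
by apply: continuous_comp; [exact: pp.1|exact: cg].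
Qed.

Hypothesis psurj : forall y, exists x, p x = y.
Hypothesis hY : hausdorff_space Y.
Hypothesis lcY : locally_compact [set: Y].

Let image_comp_preimage (g : Y -> R) (A : set R) :
  p @` ((g \o p) @^-1` A) = g @^-1` A.
Proof.
apply/seteqP; split=> [_ [x gx <-]//|y gy].
by have [x pxy] := psurj y; exists x => //; rewrite /= pxy.
Qed.

(** A closed surjection is a quotient map. *)
Lemma continuous_descend (g : Y -> R) : continuous (g \o p) -> continuous g.
Proof.
move=> /continuous_closedP cgp; apply/continuous_closedP => A clA.
by rewrite -image_comp_preimage; apply: proper_closed => //; exact: cgp.
Qed.

Lemma C0_descend (g : Y -> R) : C0 (g \o p) -> C0 g.
Proof.
move=> [cg kg]; split=> [|e e0]; first exact: continuous_descend.
rewrite -[X in compact X](image_comp_preimage g [set r | e <= `|r|]).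
by apply: compact_image; [exact: pp.1|exact: kg].
Qed.

End QuotientFunctions.

Section ImageMeasure.
Variables (R : realType) (X Y : pmetricType R) (f : X -> Y).
Hypothesis cf : continuous f.

Lemma continuous_measurable_borel :
  measurable_fun setT (f : borel X -> borel Y).
Proof.
apply: (@measurability _ _ (borel X) (borel Y) setT f (@open Y)) => //.
move=> _ [U oU <-]; rewrite setTI.
by apply: open_measurable_borel; move/continuousP : cf; exact.
Qed.

Lemma measurable_preimage_borel (B : set (borel Y)) :
  measurable B -> measurable (f @^-1` B : set (borel X)).
Proof.
by move=> mB; rewrite -[X in measurable X]setTI; exact: continuous_measurable_borel.
Qed.

Variable P : probability (borel X) R.

(** As for [regularization], the proof is an argument for the sake of
    inference. *)
Definition image_prob of continuous f : set (borel Y) -> \bar R :=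
  pushforward P (f : borel X -> borel Y).

Local Notation fP := (image_prob cf).
Local Open Scope ereal_scope.

Let mf := continuous_measurable_borel.

Let fP0 : fP set0 = 0. Proof. exact: (measure0 (pushforward P _)). Qed.

Let fP_ge0 B : 0 <= fP B. Proof. exact: measure_ge0. Qed.

Let fP_sigma_additive : semi_sigma_additive fP.
Proof. exact: (@measure_semi_sigma_additive _ _ _ (pushforward P _)). Qed.

HB.instance Definition _ := isMeasure.Build _ _ _ fP
  fP0 fP_ge0 fP_sigma_additive.

Let fP_setT : fP setT = 1.
Proof. by rewrite /image_prob /pushforward preimage_setT probability_setT. Qed.

HB.instance Definition _ := Measure_isProbability.Build _ _ _ fP fP_setT.

End ImageMeasure.

Lemma image_prob_regular (R : realType) (X Y : pmetricType R) (f : X -> Y)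
    (cf : continuous f) (P : probability (borel X) R) :
  regular_measure P -> regular_measure (image_prob P cf).
Proof.
move=> rP; apply: regular_inner => B mB e e0.
have mfB := measurable_preimage_borel cf mB.
have [K [cK KB PK]] := inner_regular rP mfB e0.
have cfK : compact (f @` K) by exact: compact_image.
exists (f @` K); split => //; first by move=> _ [x Kx <-]; exact: KB.
apply: (le_trans PK); rewrite leeD2r//; apply: le_measure.
- by apply/mem_set; exact: compact_measurable_borel.
- apply/mem_set; apply: measurable_preimage_borel => //.
  exact: compact_measurable_borel.
- exact: preimage_image.
Qed.

(** Splitting into positive and negative parts settles the equality whether or
    not [g] is integrable. *)
Lemma Rintegral_image (R : realType) (X Y : pmetricType R) (p : X -> Y)
    (mu : giry (borel X) R) (nu : giry (borel Y) R) (g : Y -> R) :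
  (forall B : set (borel Y), measurable B ->
    nu B = pushforward mu (p : borel X -> borel Y) B) ->
  continuous p -> continuous g -> \int[nu]_y g y = \int[mu]_x g (p x).
Proof.
move=> numu cp cg; have mp := continuous_measurable_borel cp.
have mg : measurable_fun [set: borel Y] (g : borel Y -> measurableTypeR R).
  apply: (measurability _ (RGenOInfty.measurableE R)) => _ [_ [a ->] <-].
  rewrite setTI; apply: open_measurable_borel.
  by move/continuousP : cg; apply; exact: interval_open.
have /measurable_EFinP mEg := mg.
rewrite /Rintegral; congr fine.
rewrite (@eq_measure_integral _ _ _ setT (giry_map mp mu)); last first.
  by move=> B mB _; exact: numu.
rewrite integralE [RHS]integralE; congr (_ - _)%E.
  rewrite -[LHS]/(giry_int _ _) (giry_int_map mp mu (measurable_funepos mEg))//.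
  by apply: eq_integral => y _; rewrite /= !funeposE.
rewrite -[LHS]/(giry_int _ _) (giry_int_map mp mu (measurable_funeneg mEg))//.
by apply: eq_integral => y _; rewrite /= !funenegE.
Qed.

(** The image of a compact subset of [f @^-1` U] and the preimage of a compact
    subset of [U] are again compact, hence each supremum bounds the other. *)
Lemma inner_mass_preimage (R : realType) (X Y : pmetricType R) (f : X -> Y)
    (mX : set X -> R) (mY : set Y -> R) (U : set Y) :
  proper_map f -> (forall A B, A `<=` B -> mX A <= mX B) ->
  (forall K, compact K -> mX (f @^-1` K) = mY K) ->
  inner_mass mX (f @^-1` U) = inner_mass mY U.
Proof.
move=> [cf kf] mono mXY; apply/eqP; rewrite eq_le; apply/andP; split.
  apply: inner_mass_le => K cK KU; have cfK := compact_image cf cK.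
  rewrite (@le_trans _ _ (mY (f @` K))%:E)//.
    by rewrite -mXY// lee_fin; apply: mono; exact: preimage_image.
  by apply: le_inner_mass_compact => // _ [x Kx <-]; exact: KU.
apply: inner_mass_le => K cK KU; rewrite -mXY//.
apply: le_inner_mass_compact; first exact: kf.
by move=> x; exact: KU.
Qed.

(** * Lifting invariant probabilities along a proper factor map *)

Section Factor.
Variables (R : realType) (S : semigroupType) (X Y : pmetricType R).
Variables (actX : S -> X -> X) (actY : S -> Y -> Y) (p : X -> Y).
Hypothesis lcancel : forall s t1 t2 : S, (s * t1 = s * t2)%g -> t1 = t2.
Hypothesis amS : left_amenable S R.
Hypothesis lcY : locally_compact [set: Y].
Hypotheses (paX : proper_action actX) (paY : proper_action actY).
Hypothesis pfm : proper_factor_map actX actY p.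

Let cp : continuous p. Proof. by case: pfm => [[]]. Qed.
Let pp : proper_map p. Proof. by case: pfm. Qed.
Let psurj y : exists x, p x = y.
Proof. by case: pfm => -[_ /(_ y I)[x _ <-] _] _; exists x. Qed.
Let pE s x : p (actX s x) = actY s (p x).
Proof. by case: pfm => -[]. Qed.
Let cactX s : continuous (actX s). Proof. by have [_ /(_ s)[]] := paX. Qed.
Let cactY s : continuous (actY s). Proof. by have [_ /(_ s)[]] := paY. Qed.

(** One inclusion is continuity; the other holds because [p] is closed. *)
Lemma image_orbit_closure x :
  p @` orbit_closure actX x = orbit_closure actY (p x).
Proof.
have pO : p @` range (actX ^~ x) = range (actY ^~ (p x)).
  apply/seteqP; split=> [_ [_ [s _ <-] <-]|_ [s _ <-]]; rewrite -?pE.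
    by exists s.
  by exists (actX s x) => //; exists s.
apply/seteqP; split; first by rewrite /orbit_closure -pO; exact: image_closure.
rewrite /orbit_closure -pO => y cly.
have /closure_id -> : closed (p @` closure (range (actX ^~ x))).
  apply: proper_closed => //; first exact: metric_hausdorff.
  exact: closed_closure.
by apply: closureS cly; apply: image_subset; exact: subset_closure.
Qed.

Lemma escapes_factor x : escapes actY (p x) <-> escapes actX x.
Proof.
rewrite /escapes -image_orbit_closure; split; apply: contra_not => cO.
  exact: (compact_image cp).
apply: subclosed_compact (pp.2 _ cO) _; first exact: closed_closure.
exact: preimage_image.
Qed.

Lemma orbit_closure_invariant x s :
  orbit_closure actX x `<=` actX s @^-1` orbit_closure actX x.
Proof.
move=> z Oz; have [actM _] := paX.
have := image_closure (cactX (s := s)) (imageP (actX s) Oz).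
by apply: closureS => _ [_ [t _ <-] <-]; exists (s * t)%g.
Qed.

Lemma image_invariant_prob x (mu : probability (borel X) R) :
  invariant_probs actX (orbit_closure actX x) mu ->
  invariant_probs actY (orbit_closure actY (p x)) (image_prob mu cp).
Proof.
move=> [rmu mu0 imu]; split; first exact: image_prob_regular.
- apply/eqP; rewrite eq_le measure_ge0 andbT -mu0.
  apply: (@le_measure _ _ _ mu (p @^-1` ~` orbit_closure actY (p x))).
  + apply/mem_set; apply: measurable_preimage_borel => //.
    by apply: measurableC; apply: closed_measurable_borel; exact: closed_closure.
  + apply/mem_set; apply: measurableC; apply: closed_measurable_borel.
    exact: closed_closure.
  + apply: subsetC; rewrite -image_orbit_closure; exact: preimage_image.
- move=> s B mB; have mpB := measurable_preimage_borel cp mB.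
  rewrite /pushforward /= /image_prob /pushforward -(imu s _ mpB).
  by congr (mu _); apply/seteqP; split=> z /=; rewrite pE.
Qed.

(** A choice with no regularity at all: only finitely additive set functions
    are pulled back along [sigma]. *)
Lemma section_in (L : set X) : exists sigma : Y -> X,
  (forall y, p (sigma y) = y) /\ (forall y, (p @` L) y -> L (sigma y)).
Proof.
have /choice[sigma sP] y : exists x, p x = y /\ ((p @` L) y -> L x).
  have [[x Lx <-]|nLy] := pselect ((p @` L) y); first by exists x.
  by have [x px] := psurj y; exists x.
by exists sigma; split=> y; have [] := sP y.
Qed.

(** Extend [nu] to all subsets of [Y], pull it back along a section of [p] with
    values in the orbit closure of [x] wherever possible, and average. *)
Lemma lift_content x (nu : probability (borel Y) R) :
  invariant_probs actY (orbit_closure actY (p x)) nu ->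
  exists m : set X -> R, [/\ fa_prob m,
    forall s A, m (actX s @^-1` A) = m A,
    m (~` orbit_closure actX x) = 0 &
    forall B : set (borel Y), measurable B -> m (p @^-1` B) = fine (nu B)].
Proof.
move=> [_ nu0 inu]; have [F FF] := amS; have [actM _] := paX.
have [n [fn nE]] := fa_extension nu.
pose L := orbit_closure actX x.
have [sigma [psigma Lsigma]] := section_in L.
pose m0 (A : set X) : R := n (sigma @^-1` A).
have fm0 : fa_prob m0.
  case: fn => n0 n1 nD; split=> [A||A B AB]; [exact: n0|exact: n1|].
  by rewrite /m0 preimage_setU nD// -preimage_setI AB preimage_set0.
have [m [fm mi mc]] := fa_average actM lcancel FF fm0.
exists m; split => // [|B mB].
  (* [sigma] sends [p @` L] into [L], which every [actX t] preserves. *)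
  apply: mc => t; apply/eqP; rewrite eq_le; case: (fm0) => -> _ _; rewrite andbT.
  have mO : measurable (~` orbit_closure actY (p x) : set (borel Y)).
    by apply: measurableC; apply: closed_measurable_borel; exact: closed_closure.
  rewrite -[leRHS](_ : n (~` orbit_closure actY (p x)) = 0); last first.
    by rewrite nE// nu0.
  apply: (le_fa_prob fn) => y; apply: contra_not.
  rewrite -image_orbit_closure => /Lsigma; exact: orbit_closure_invariant.
(* Translates in [X] lie over translates in [Y], where [nu] is invariant. *)
apply: mc => t; rewrite /m0 [X in n X](_ : _ = actY t @^-1` B); last first.
  by apply/seteqP; split=> y /=; rewrite pE psigma.
rewrite nE; first by congr fine; exact: inu.
exact: (measurable_preimage_borel (cactY (s := t))).
Qed.

(** Regularize the finitely additive lift.  Everything is checked on open sets,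
    where the regularization is an inner mass and commutes with proper maps. *)
Lemma lift_invariant_prob x (nu : probability (borel Y) R) :
  invariant_probs actY (orbit_closure actY (p x)) nu ->
  exists2 mu, invariant_probs actX (orbit_closure actX x) mu &
    measure_eq nu (image_prob mu cp).
Proof.
move=> Inu; have [m [fm mi m0 mp]] := lift_content Inu.
case: Inu => rnu _ _.
have mono A B : A `<=` B -> m A <= m B by exact: le_fa_prob.
have inner_nu (V : set Y) : open V -> inner_mass m (p @^-1` V) = nu V.
  move=> oV; rewrite (inner_mass_preimage V pp mono (mY := fun K => fine (nu K))).
    have [_ ->] := rnu V (open_measurable_borel oV).
    rewrite /inner_mass; congr ereal_sup; apply: eq_imagel => K [cK _].
    by rewrite fineK// fin_num_measure//; exact: compact_measurable_borel.
  by move=> K cK; apply: mp; exact: compact_measurable_borel.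
have tight : inner_mass m setT = 1%E.
  by rewrite -[setT](preimage_setT p) inner_nu ?probability_setT//; exact: openT.
pose mu : probability (borel X) R := regularization fm tight.
have muE U : open U -> mu U = inner_mass m U by exact: regularization_open.
exists mu; [split|].
- exact: regularization_regular.
- have oL : open (~` orbit_closure actX x) by exact/closed_openC/closed_closure.
  apply/eqP; rewrite [_ (~` _)](muE _ oL) eq_le inner_mass_ge0// andbT.
  by apply: inner_mass_le => K cK KL; rewrite lee_fin -m0; exact: mono.
- move=> s A mA; apply: (@eq_open_borel R X (image_prob mu (cactX (s := s))) mu) => // U oU.
  rewrite [RHS]muE//; have oV : open (actX s @^-1` U).
    by move/continuousP : (cactX (s := s)); exact.
  rewrite [LHS](muE _ oV); apply: inner_mass_preimage => //.
  exact: paX.2.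
- apply: eq_open_borel => V oV; rewrite -inner_nu// [RHS]muE//.
  by move/continuousP : cp; exact.
Qed.

(** Existence on [Y] by taking images; uniqueness, and nonexistence at escaping
    points, by lifting. *)
Lemma factor_pointwise_uniquely_ergodic :
  pointwise_uniquely_ergodic actX -> pointwise_uniquely_ergodic actY.
Proof.
move=> ueX y; have [x <-] := psurj y; have [eX neX] := ueX x.
split=> [/escapes_factor ex|nex].
  rewrite -subset0 => nu /lift_invariant_prob[mu + _].
  by rewrite (eX ex).
have [|mu Imu mu_uniq] := neX; first by move=> /escapes_factor.
exists (image_prob mu cp); first exact: image_invariant_prob.
move=> nu /lift_invariant_prob[mu' Imu' nuE] B mB.
rewrite nuE//; apply: mu_uniq => //; exact: measurable_preimage_borel.
Qed.

Lemma ergodic_map_factor : pointwise_uniquely_ergodic actX ->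
  forall (x : X) (B : set (borel Y)), measurable B ->
    (ergodic_map actY (p x) : giry (borel Y) R) B =
    pushforward (ergodic_map actX x : giry (borel X) R)
      (p : borel X -> borel Y) B.
Proof.
move=> ueX x B mB; have ueY := factor_pointwise_uniquely_ergodic ueX.
rewrite /ergodic_map /pushforward.
case: pselect => [ex|nex]; case: pselect => // nex'.
- by exfalso; apply: nex'; exact/escapes_factor.
- by exfalso; apply: nex; exact/escapes_factor.
have [_ /(_ nex)[nu Inu nu_uniq]] := ueY (p x).
have [_ /(_ nex')[mu Imu _]] := ueX x.
have gX : invariant_probs actX (orbit_closure actX x)
    (get (invariant_probs actX (orbit_closure actX x))).
  by apply: getPex; exists mu.
have gY : invariant_probs actY (orbit_closure actY (p x))
    (get (invariant_probs actY (orbit_closure actY (p x)))).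
  by apply: getPex; exists nu.
rewrite [LHS](nu_uniq _ gY _ mB).
by rewrite -[LHS](nu_uniq _ (image_invariant_prob gX) _ mB).
Qed.

End Factor.

(** * Passing continuity, decay and uniform convergence to the factor *)

Lemma uniform_cvg_normP (R : realType) (T : choiceType) (u : (T -> R)^nat)
    (g : T -> R) :
  {uniform, u n @[n --> \oo] --> g} <->
  forall e : R, 0 < e -> \forall n \near \oo, forall x, `|g x - u n x| < e.
Proof.
split=> [ug e e0|ug].
  have := ug [set h : T -> R | forall x, `|g x - h x| < e].
  apply; apply/uniform_nbhs; exists [set xy : R * R | `|xy.1 - xy.2| < e].
  split; last by move=> h hg x; exact: hg.
  by rewrite -entourage_ballE; exists e.
move=> A /uniform_nbhs[E [+ EA]].
rewrite -entourage_ballE => -[e /= e0 eE].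
apply: filterS (ug e e0) => n un; apply: EA => x _; apply: eE => /=.
exact: un.
Qed.

Lemma cvg_initial_topology (I : Type) (T : choiceType) (U : topologicalType)
    (f : T -> U) (F : set_system I) (u : I -> T) (t : T) :
  Filter F -> f (u i) @[i --> F] --> f t ->
  u i @[i --> F] --> (t : initial_topology f).
Proof.
move=> FF ft A [_ [[B oB <-] Bt BA]].
have FB : F (u @^-1` (f @^-1` B)) by apply: ft; exact: open_nbhs_nbhs.
by apply: filterS FB => i; exact: BA.
Qed.

Lemma continuous_weak_starP (R : realType) (X : pmetricType R)
    (Z : topologicalType) (h : Z -> weak_star X) :
  continuous h <->
  forall f : X -> R, C0 f -> continuous (fun z => \int[(h z : giry (borel X) R)]_x f x : R).
Proof.
split=> [ch f Cf|ch].
  pose f' : set_type (@C0 R X) := SigSub (mem_set Cf).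
  have -> : (fun z => \int[(h z : giry (borel X) R)]_x f x : R) =
      proj f' \o (@C0_eval R X) \o h.
    by apply/funext => z.
  move=> z; apply: (@continuous_comp Z (weak_star X) _ h); first exact: ch.
  apply: (@continuous_comp (weak_star X)
    {ptws set_type (@C0 R X) -> R} _ (@C0_eval R X)); first exact: initial_continuous.
  exact: proj_continuous.
move=> z; apply: cvg_initial_topology; apply/cvg_sup => f.
by apply: cvg_initial_topology; apply: ch; exact: set_valP.
Qed.

Section FactorFunctions.
Variables (R : realType) (S : semigroupType) (X Y : pmetricType R).
Variables (actX : S -> X -> X) (actY : S -> Y -> Y) (p : X -> Y).
Hypothesis pfm : proper_factor_map actX actY p.
Hypothesis lcY : locally_compact [set: Y].

Let pp : proper_map p. Proof. by case: pfm. Qed.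
Let psurj y : exists x, p x = y.
Proof. by case: pfm => -[_ /(_ y I)[x _ <-] _] _; exists x. Qed.
Let hY : hausdorff_space Y := @metric_hausdorff R Y.
Let pE s x : p (actX s x) = actY s (p x).
Proof. by case: pfm => -[]. Qed.

Lemma average_factor (F : {fset S}) (f : Y -> R) x :
  average actX F (f \o p) x = average actY F f (p x).
Proof.
by rewrite /average; congr (_ * _); apply: eq_bigr => t _; rewrite /= pE.
Qed.

(** The uniform limit of the averages of [f \o p] is constant on the fibres of
    [p], because these averages are; so it descends to [Y]. *)
Lemma uniform_action_factor : uniform_action actX -> uniform_action actY.
Proof.
move=> uX F FF f Cf; have [g Cg /uniform_cvg_normP ug] := uX F FF _ (C0_comp pp Cf).
have [sigma psigma] := choice psurj.
have gp : (g \o sigma) \o p = g.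
  apply/funext => x /=; apply/eqP; rewrite -subr_eq0 -normr_le0.
  apply/ler_addgt0Pl => e e0; rewrite addr0.
  have e20 : 0 < e / 2 by rewrite divr_gt0.
  have [n _ /(_ n (leqnn n)) un] := ug _ e20.
  have := un (sigma (p x)); have := un x.
  rewrite !average_factor psigma.
  set a := average _ _ _ _ => gx gs.
  rewrite (_ : _ - _ = (g (sigma (p x)) - a) - (g x - a)); last by ring.
  by rewrite (le_trans (ler_normB _ _))// (splitr e) lerD// ltW.
exists (g \o sigma); first by apply: (C0_descend pp psurj hY lcY); rewrite gp.
apply/uniform_cvg_normP => e e0; apply: filterS (ug e e0) => n un y.
by rewrite -(psigma y) -average_factor -[(g \o sigma) _]/(((g \o sigma) \o p) _) gp.
Qed.

Section ErgodicMaps.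
Hypothesis ergodic_factor :
  forall (x : X) (B : set (borel Y)), measurable B ->
    (ergodic_map actY (p x) : giry (borel Y) R) B =
    pushforward (ergodic_map actX x : giry (borel X) R)
      (p : borel X -> borel Y) B.

Lemma ergodic_map_integral (g : Y -> R) : continuous g ->
  (fun y => \int[(ergodic_map actY y : giry (borel Y) R)]_z g z : R) \o p =
  (fun x => \int[(ergodic_map actX x : giry (borel X) R)]_z (g \o p) z : R).
Proof.
move=> cg; apply/funext => x.
by apply: Rintegral_image => //; [exact: ergodic_factor|exact: pp.1].
Qed.

Lemma continuous_ergodic_map_factor :
  continuous (ergodic_map actX) -> continuous (ergodic_map actY).
Proof.
move=> /continuous_weak_starP cX; apply/continuous_weak_starP => g Cg.
apply: (continuous_descend pp psurj hY lcY); rewrite ergodic_map_integral; last by case: Cg.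
exact: (cX _ (C0_comp pp Cg)).
Qed.

Lemma vanishes_at_infinity_factor :
  vanishes_at_infinity actX -> vanishes_at_infinity actY.
Proof.
move=> vX g Cg; apply: (C0_descend pp psurj hY lcY).
rewrite ergodic_map_integral; last by case: Cg.
exact: (vX _ (C0_comp pp Cg)).
Qed.

End ErgodicMaps.

End FactorFunctions.

Theorem proposition6p7 (R : realType) (S : semigroupType)
    (X Y : pmetricType R) (actX : S -> X -> X) (actY : S -> Y -> Y)
    (p : X -> Y) :
  countable [set: S] -> bicancellative S -> left_amenable S R ->
  separable X -> locally_compact [set: X] ->
  separable Y -> locally_compact [set: Y] ->
  proper_action actX -> proper_action actY ->
  proper_factor_map actX actY p ->
  [/\ pointwise_uniquely_ergodic actX ->
        pointwise_uniquely_ergodic actY /\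
        (forall (x : X) (B : set (borel Y)), measurable B ->
           (ergodic_map actY (p x) : giry (borel Y) R) B =
           pushforward (ergodic_map actX x : giry (borel X) R)
             (p : borel X -> borel Y) B),
      continuously_pointwise_ergodic actX ->
        continuously_pointwise_ergodic actY,
      continuously_pointwise_ergodic actX -> vanishes_at_infinity actX ->
        vanishes_at_infinity actY &
      uniform_action actX -> uniform_action actY].
Proof.
move=> _ [_ cancel_left] amS _ _ _ lcY paX paY pfm.
have lcancel (s t1 t2 : S) : (s * t1 = s * t2)%g -> t1 = t2 := @cancel_left s t1 t2.
have factorE := ergodic_map_factor lcancel amS lcY paX paY pfm.
have factor_ue := factor_pointwise_uniquely_ergodic lcancel amS lcY paX paY pfm.
split.
- by move=> ueX; split; [exact: factor_ue|exact: factorE].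
- move=> [ueX cX]; split; first exact: factor_ue.
  exact: (continuous_ergodic_map_factor pfm lcY (factorE ueX)).
- move=> [ueX _].
  exact: (vanishes_at_infinity_factor pfm lcY (factorE ueX)).
- exact: (uniform_action_factor pfm lcY).
Qed.
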